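(* Let $\kappa$ be a singular (uncountable) cardinal with $2^{<\kappa}=\kappa$, and let $X$ be a nonempty regular Hausdorff space of weight at most $\kappa$ such that every open subset of $X$ is a union of at most $\operatorname{cof}(\kappa)$-many closed sets (i.e. $\kappa\text{-}\boldsymbol{\Sigma}^0_1(X)\subseteq\operatorname{cof}(\kappa)^+\text{-}\boldsymbol{\Sigma}^0_2(X)$). Let $\alpha$ be such that $1+\alpha<\operatorname{ord}_\kappa(X)$, and let $\widehat{\alpha}=\operatorname{cof}(\alpha)$ if $\alpha$ is limit, and $\widehat{\alpha}=\operatorname{cof}(\kappa)$ otherwise. (1) If $\alpha$ is even, then $\kappa\text{-}\boldsymbol{\Sigma}^0_{1+\alpha}(X)$ is not closed under complements or intersections of size $\widehat{\alpha}$ (neither of the two), and $\kappa\text{-}\boldsymbol{\Pi}^0_{1+\alpha}(X)$ is not closed under complements or unions of size $\widehat{\alpha}$ (neither of the two). If furthermore $\alpha>0$, then $\kappa\text{-}\boldsymbol{\Delta}^0_{1+\alpha}(X)$ is not closed under unions or intersections of size $\widehat{\alpha}$ (neither of the two), and the same is true for $\alpha=0$ if $X\subseteq{}^{\kappa}2$. (2) If $\alpha$ is odd, then $\kappa\text{-}\boldsymbol{\Sigma}^0_{1+\alpha}(X)=\kappa\text{-}\boldsymbol{\Pi}^0_{1+\alpha}(X)=\kappa\text{-}\boldsymbol{\Delta}^0_{1+\alpha}(X)$ is not closed under unions or intersections of size $\operatorname{cof}(\kappa)$ (neither of the two).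
   Context: For a topological space $X$ and an ordinal $\gamma>\omega$, define by recursion on ordinals $\alpha\ge 1$: $\gamma\text{-}\boldsymbol{\Sigma}^0_1(X)$ is the family of open sets; for $\alpha>1$, $\gamma\text{-}\boldsymbol{\Sigma}^0_\alpha(X)$ is the family of all unions $\bigcup_{\xi<\delta}A_\xi$ with $\delta<\gamma$ and each $A_\xi\in\bigcup_{1\le\beta<\alpha}\gamma\text{-}\boldsymbol{\Pi}^0_\beta(X)$; $\gamma\text{-}\boldsymbol{\Pi}^0_\alpha(X)$ is the family of complements of sets in $\gamma\text{-}\boldsymbol{\Sigma}^0_\alpha(X)$; $\gamma\text{-}\boldsymbol{\Delta}^0_\alpha(X)=\gamma\text{-}\boldsymbol{\Sigma}^0_\alpha(X)\cap\gamma\text{-}\boldsymbol{\Pi}^0_\alpha(X)$. $\gamma\text{-}\mathbf{Bor}(X)$ is the smallest family of subsets of $X$ containing the open sets and closed under complements and well-ordered unions of length less than $\gamma$. The order is $\operatorname{ord}_\gamma(X)=\min\{\alpha\in\mathrm{Ord}\mid\gamma\text{-}\boldsymbol{\Sigma}^0_\alpha(X)=\gamma\text{-}\mathbf{Bor}(X)\}$; one has $\operatorname{ord}_\kappa(X)\le\kappa^+$ for $\kappa$ singular. Every ordinal $\alpha$ is written uniquely as $\alpha=\lambda+n$ with $n<\omega$ and $\lambda=0$ or $\lambda$ limit; $\alpha$ is even (odd) if $n$ is even (odd). The space ${}^{\kappa}2$ carries the bounded topology, generated by the sets $[s]=\{x\in{}^{\kappa}2\mid s\subseteq x\}$ for $s\in{}^{<\kappa}2$,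 and subsets of it carry the subspace topology. *)

(* Defs.v *)
From HB Require Import structures.
From mathcomp Require Import all_boot all_order.
From mathcomp Require Import boolp wochoice classical_sets functions cardinality.
From mathcomp Require Import topology.

Set Implicit Arguments.
Unset Strict Implicit.
Unset Printing Implicit Defensive.

Local Open Scope classical_set_scope.
Local Open Scope card_scope.

(* Ordinals are represented by well-ordered types; two of them are the same    *)
(* ordinal when they are isomorphic (=~o), and every notion below that takes   *)
(* an ordinal is invariant under isomorphism. The elements of (the carrier of) *)
(* an ordinal stand for the ordinals strictly below it.                        *)
Record wordinal := WOrdinal {
  ocarrier :> Type;
  wle : ocarrier -> ocarrier -> bool;
  wleP : well_order wle }.

Arguments wle {o} : rename.

Definition wlt (o : wordinal) : rel o := fun x y => ~~ wle y x.
Arguments wlt {o}.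

Definition oeq (a b : wordinal) : Prop :=
  exists2 f : a -> b, {mono f : x y / wle x y} & range f = setT.

Definition olt (a b : wordinal) : Prop :=
  exists z : b, exists2 f : a -> b,
    {mono f : x y / wle x y} & range f = [set y | wlt y z].

Definition ole (a b : wordinal) : Prop := olt a b \/ oeq a b.

Notation "a '=~o' b" := (oeq a b) (at level 70, no associativity).
Notation "a '<o' b" := (olt a b) (at level 70, no associativity).
Notation "a '<=o' b" := (ole a b) (at level 70, no associativity).

Section well_order_facts.
Variables (T : Type) (R : rel T).

Lemma well_order_min : well_order R ->
  forall A : set T, A !=set0 -> exists2 z, A z & forall x, A x -> R z x.
Proof.
move=> woR A [x Ax]; have [|z [[Az zmin] _]] := woR [pred x | `[< A x >]].
  by exists x; apply/asboolP.
exists z; first by move: Az => /asboolP.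
by move=> y Ay; apply: zmin; apply/asboolP.
Qed.

Lemma well_order_total : well_order R -> total R.
Proof.
move=> /well_order_min woR x y.
have [|z [->|->] zmin] := woR [set t | t = x \/ t = y]; first by exists x; left.
- by rewrite zmin//; right.
- by rewrite (zmin x) ?orbT//; left.
Qed.

Lemma well_order_anti : well_order R -> antisymmetric R.
Proof.
move=> woR x y /andP[xy yx]; have tot := well_order_total woR.
have rfl z : R z z by have := tot z z; rewrite orbb.
have [|z [_ zuniq]] := woR [pred t | `[< t = x \/ t = y >]].
  by exists x; apply/asboolP; left.
have mx : minimum_of R [pred t | `[< t = x \/ t = y >]] x.
  by split=> [|t /asboolP[->|->]//]; apply/asboolP; left.
have my : minimum_of R [pred t | `[< t = x \/ t = y >]] y.
  by split=> [|t /asboolP[->|->]//]; apply/asboolP; right.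
by rewrite -(zuniq _ mx) -(zuniq _ my).
Qed.

Lemma min_well_order : antisymmetric R ->
  (forall A : set T, A !=set0 -> exists2 z, A z & forall x, A x -> R z x) ->
  well_order R.
Proof.
move=> Ranti Rmin; apply: antisymmetric_well_order => // A [x Ax].
have [|z Az zmin] := Rmin [set x | x \in A]; first by exists x.
by exists z; split=> // y Ay; apply: zmin.
Qed.

End well_order_facts.

(* The carrier is not 'I_n, whose universe would leave no room for sets of      *)
(* ordinals.                                                                   *)
Lemma onat_subproof (n : nat) :
  well_order (fun i j : {i : nat | (i < n)%N} => (sval i <= sval j)%N).
Proof.
apply: min_well_order => [i j /anti_leq/val_inj//|A [i Ai]].
have [m /asboolP[j Aj jm] mmin] :=
  @ex_minnP (fun m => `[< exists2 j, A j & sval j = m >])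
    (ex_intro _ (sval i) (introT (asboolP _) (ex_intro2 _ _ i Ai erefl))).
by exists j => // x Ax; rewrite jm; apply: mmin; apply/asboolP; exists x.
Qed.

Definition onat (n : nat) : wordinal := WOrdinal (@onat_subproof n).

Definition sum_wle (a b : wordinal) : rel (a + b) := fun u v =>
  match u, v with
  | inl x, inl y => wle x y
  | inl _, inr _ => true
  | inr _, inl _ => false
  | inr x, inr y => wle x y
  end.

Lemma oadd_subproof (a b : wordinal) : well_order (@sum_wle a b).
Proof.
apply: min_well_order => [[x|x] [y|y]//= /(well_order_anti (@wleP _))->//|A Ane].
have [[x Ax]|nA] := pselect (exists x, A (inl x)).
  have [|z Az zmin] := well_order_min (@wleP a) (A := [set x | A (inl x)]).
    by exists x.
  by exists (inl z) => // -[t|t]//= /zmin.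
have [|z Az zmin] := well_order_min (@wleP b) (A := [set x | A (inr x)]).
  by case: Ane => -[x Ax|x Ax]; [case: nA; exists x|exists x].
by exists (inr z) => // -[t|t]//= At; [case: nA; exists t|exact: zmin].
Qed.

Definition oadd (a b : wordinal) : wordinal := WOrdinal (@oadd_subproof a b).

(* The least ordinal satisfying P; the value is junk when P is empty. *)
Definition omin (P : wordinal -> Prop) : wordinal :=
  if pselect (exists o, P o /\ forall o', P o' -> o <=o o') is left h
  then projT1 (cid h) else onat 0.

Definition olimit (a : wordinal) : Prop :=
  (exists x : a, True) /\ forall x : a, exists y, wlt x y.

Definition has_parity (p : bool) (a : wordinal) : Prop :=
  exists (l : wordinal) (n : nat),
    [/\ l =~o onat 0 \/ olimit l, a =~o oadd l (onat n) & odd n = p].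

Definition oeven := has_parity false.
Definition oodd := has_parity true.

Definition ocard (k : wordinal) : Prop :=
  forall a, a <o k -> ~ ([set: k] #<= [set: a]).

Definition ocard_succ (k : wordinal) : wordinal :=
  omin (fun a => ~ ([set: a] #<= [set: k])).

Definition cofinal_map (m a : wordinal) (f : m -> a) : Prop :=
  forall x : a, exists i : m, wle x (f i).

Definition cof (a : wordinal) : wordinal :=
  omin (fun m => exists f : m -> a, cofinal_map f).

Definition singular (k : wordinal) : Prop :=
  [/\ ocard k, infinite_set [set: k] & cof k <o k].

(* For k an infinite cardinal, this is the set of all binary sequences of      *)
(* length less than k, the length being an element of k.                       *)
Definition bstring (k : wordinal) : Type := {a : k & {b : k | wlt b a} -> bool}.

(* 2^{<k} = k *)
Definition pow2lt_eq (k : wordinal) : Prop := [set: bstring k] #= [set: k].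

Definition gcantor (k : wordinal) : Type := k -> bool.

Definition gcyl (k : wordinal) (s : bstring k) : set (gcantor k) :=
  [set x | forall b : {b : k | wlt b (projT1 s)}, x (sval b) = projT2 s b].

HB.instance Definition _ (k : wordinal) := gen_eqMixin (gcantor k).
HB.instance Definition _ (k : wordinal) := gen_choiceMixin (gcantor k).
(* the bounded topology *)
HB.instance Definition _ (k : wordinal) :=
  @isSubBaseTopological.Build (gcantor k) (set (gcantor k)) (range (@gcyl k)) id.

(* X is, up to homeomorphism, a subspace of gcantor k. *)
Definition embeds_gcantor (k : wordinal) (X : topologicalType) : Prop :=
  exists2 e : X -> gcantor k, injective e &
    forall U : set X, open U <-> exists2 V, open V & e @^-1` V = U.

Definition weight_le (X : topologicalType) (k : wordinal) : Prop :=
  exists2 B : set (set X), basis B & B #<= [set: k].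

Section closure_properties.
Variable X : Type.
Implicit Type F : set (set X).

Definition compl_closed F : Prop := forall A, F A -> F (~` A).

Definition union_closed (m : wordinal) F : Prop :=
  forall A : m -> set X, (forall i, F (A i)) -> F (\bigcup_i A i).

Definition inter_closed (m : wordinal) F : Prop :=
  forall A : m -> set X, (forall i, F (A i)) -> F (\bigcap_i A i).

End closure_properties.

Section borel_hierarchy.
Variables (X : topologicalType) (g : wordinal).

(* The recursion on a is expressed by an inductive family; the recursive       *)
(* clauses are bSigma1E and bSigmaE below.                                     *)
Inductive bSigma : wordinal -> set X -> Prop :=
| bSigma_open a U : a =~o onat 1 -> open U -> bSigma a U
| bSigma_union a (d : wordinal) (b : d -> wordinal) (A : d -> set X) :
    onat 1 <o a -> d <o g ->
    (forall i, onat 1 <=o b i) -> (forall i, b i <o a) ->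
    (forall i, bSigma (b i) (~` A i)) ->
    bSigma a (\bigcup_i A i).

Lemma oeq1_olt1 a : a =~o onat 1 -> ~ onat 1 <o a.
Proof.
move=> [f fmono _] [z [h _ hE]].
have one (u v : onat 1) : wle u v by case: u v => [[]//?] [[]].
pose i0 : onat 1 := exist _ 0 isT.
have : range h (h i0) by exists i0.
by rewrite hE /= /wlt -fmono one.
Qed.

Lemma bSigma1E a : a =~o onat 1 -> bSigma a = open.
Proof.
move=> a1; apply/seteqP; split=> [U SU|U]; last exact: bSigma_open.
by case: SU a1 => // c d b A c1 _ _ _ _ /oeq1_olt1.
Qed.

Definition bPi (a : wordinal) : set (set X) := [set U | bSigma a (~` U)].

Lemma bSigmaE a : onat 1 <o a -> bSigma a =
  [set U | exists (d : wordinal) (A : d -> set X), [/\ d <o g,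
     forall i, exists b, [/\ onat 1 <=o b, b <o a & bPi b (A i)] &
     U = \bigcup_i A i]].
Proof.
move=> a1; apply/seteqP; split=> [U SU|U [d [A [dg bA ->]]]].
  case: SU a1 => [c V /oeq1_olt1//|c d b A _ dg b1 bc bA _].
  by exists d, A; split=> // i; exists (b i); split=> //; exact: bA.
have [b bP] := choice bA.
by apply: (@bSigma_union a d b A) => // i; have [] := bP i.
Qed.

Definition bDelta (a : wordinal) : set (set X) := bSigma a `&` bPi a.

Definition Bor : set (set X) :=
  smallest [set F | compl_closed F /\ forall d, d <o g -> union_closed d F] open.

Definition ord_bor : wordinal :=
  omin (fun a => onat 1 <=o a /\ bSigma a = Bor).

End borel_hierarchy.

Arguments bSigma : clear implicits.
Arguments bPi : clear implicits.
Arguments bDelta : clear implicits.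
Arguments Bor : clear implicits.
Arguments ord_bor : clear implicits.

Definition ohat (k a : wordinal) : wordinal :=
  if pselect (olimit a) then cof a else cof k.

(* Main.v *)
Require Import Defs.
From mathcomp Require Import all_boot all_order finmap.
From mathcomp Require Import boolp wochoice classical_sets functions cardinality.
From mathcomp Require Import topology.

Set Implicit Arguments.
Unset Strict Implicit.
Unset Printing Implicit Defensive.

Local Open Scope classical_set_scope.
Local Open Scope card_scope.

(** Write C F for the complements of the members of a family F, U F for the
    unions of fewer than k members of F, M m F for the unions of m members of F,
    and mu for the cofinality of k. Two facts about k do all the work.

    First, k is a strong limit: 2^d = k for some d < k would contradict König's
    theorem ([strong_limit]). Hence a union of fewer than k intersections of
    length m < k is an intersection of fewer than k unions, one for each choice
    function: if U F is contained in F and F in M m (C F), then U (C F) is closed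
    under complements ([lt_unions_distr]). Second, k is singular: sorting by length
    turns a union of unions, whose total length may reach k, into mu many unions
    of length less than k, so that U (U F) is contained in M mu (U F)
    ([lt_unions_lt_unions]).

    Successive levels of the hierarchy are F and U (C F), so these facts alternate.
    If F is closed under U and every member of F is a union of a fixed number
    m < k of members of C F ([additive]), the next level G is closed under
    complements and has the form U H ([selfdual], by [additive_selfdual]). From
    such a G, the next level U G is closed under U and each of its members is a
    union of mu many members of G, which are of ambiguous class in U G
    ([ambiguous_additive], by [selfdual_ambiguous]). The alternation starts at the
    open sets, which are unions of mu closed sets by hypothesis, and again at each
    limit l, where the members of the level are unions of cof l sets of lower
    levels ([limit_ambiguous]); cof l < k, as otherwise the levels below l would
    already exhaust the Borel sets ([cof_limit_lt]).

    A level below the order of the space is not the Borel algebra. At an even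
    level, which is closed under U, it is therefore not closed under complements
    ([lt_unions_not_compl_closed]); and closure under intersections, or closure of
    the ambiguous class under unions, of the relevant length would imply closure
    under complements, because every member is a union of that length of
    members of C F or of the ambiguous class. At an odd level G, closure under
    unions of length mu gives U G = U (U H) inside M mu (U H) = M mu G inside G,
    so G would be the Borel algebra. For the open sets of a subspace of the space
    of binary sequences, the ambiguous pieces come from [gcantor_ambiguous]. *)

(** * Well-ordered types as ordinals *)

Section order.
Variable a : wordinal.
Implicit Types x y z : a.

Lemma wle_total x y : wle x y || wle y x.
Proof. exact: well_order_total (@wleP a) x y. Qed.

Lemma wle_refl x : wle x x.
Proof. by have := wle_total x x; rewrite orbb. Qed.

Lemma wle_anti x y : wle x y -> wle y x -> x = y.
Proof. by move=> xy yx; apply: (well_order_anti (@wleP a)); rewrite xy. Qed.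

Lemma wle_trans x y z : wle x y -> wle y z -> wle x z.
Proof.
move=> xy yz.
have [|m mE mmin] := well_order_min (@wleP a) (A := [set t | [\/ t = x, t = y | t = z]]).
  by exists x; constructor 1.
have [mx my mz] : [/\ wle m x, wle m y & wle m z].
  by split; apply: mmin; [constructor 1|constructor 2|constructor 3].
case: mE => mE; rewrite mE in mx my mz; first by [].
  by rewrite (wle_anti xy mx).
by rewrite -(wle_anti yz my).
Qed.

Lemma wltW x y : wlt x y -> wle x y.
Proof. by rewrite /wlt; have := wle_total x y; case: (wle y x); rewrite ?orbF. Qed.

Lemma wlt_irr x : ~ wlt x x.
Proof. by rewrite /wlt wle_refl. Qed.

Lemma wltNge x y : ~ wlt x y -> wle y x.
Proof. by rewrite /wlt => /negP; rewrite negbK. Qed.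

Lemma wlt_le_trans x y z : wlt x y -> wle y z -> wlt x z.
Proof. by move=> xy yz; apply/negP => zx; case/negP: xy; exact: wle_trans zx. Qed.

Lemma wle_lt_trans x y z : wle x y -> wlt y z -> wlt x z.
Proof. by move=> xy yz; apply/negP => zx; case/negP: yz; exact: wle_trans xy. Qed.

Lemma wlt_trans x y z : wlt x y -> wlt y z -> wlt x z.
Proof. by move=> xy /wltW; exact: wlt_le_trans. Qed.

Lemma wle_eqVlt x y : wle x y -> x = y \/ wlt x y.
Proof.
move=> xy; have [|/wltNge yx] := pselect (wlt x y); first by right.
by left; exact: wle_anti.
Qed.

Lemma wlt_min (A : set a) : A !=set0 -> exists2 z, A z & forall x, wlt x z -> ~ A x.
Proof.
move=> /(well_order_min (@wleP a))[z Az zmin]; exists z => // x /negP xz Ax.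
exact/xz/zmin.
Qed.

Lemma wlt_max2 x y : exists z, wle x z /\ wle y z.
Proof.
have /orP[xy|yx] := wle_total x y; first by exists y; rewrite wle_refl.
by exists x; rewrite wle_refl.
Qed.

End order.

Lemma sval_inj (T : Type) (P : T -> Prop) : injective (@sval T P).
Proof. by move=> [x px] [y py] /= xy; subst y; rewrite (Prop_irrelevance px py). Qed.

Lemma osub_subproof (a : wordinal) (P : set a) :
  well_order (fun x y : {x : a | P x} => wle (sval x) (sval y)).
Proof.
apply: min_well_order => [x y /andP[xy yx]|A [x Ax]].
  by apply: sval_inj; exact: wle_anti.
have [|z [y Ay <-] zmin] := well_order_min (@wleP a) (A := [set sval y | y in A]).
  by exists (sval x), x.
by exists y => // t At; apply: zmin; exists t.
Qed.

Definition osub (a : wordinal) (P : set a) := WOrdinal (@osub_subproof a P).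

Definition seg (a : wordinal) (x : a) := @osub a [set y | wlt y x].

(** Initial embeddings are the maps witnessing [<=o]; unlike the two clauses of
    the definition of [<=o] they compose without a case analysis. *)
Definition iemb (a b : wordinal) (f : a -> b) :=
  {mono f : x y / wle x y} /\ forall x y, wlt y (f x) -> exists x', f x' = y.

Lemma wlt_mono (a b : wordinal) (f : a -> b) :
  {mono f : x y / wle x y} -> {mono f : x y / wlt x y}.
Proof. by move=> fm x y; rewrite /wlt fm. Qed.

Lemma wmono_inj (a b : wordinal) (f : a -> b) :
  {mono f : x y / wle x y} -> injective f.
Proof. by move=> fm x y fxy; apply: wle_anti; rewrite -fm fxy wle_refl. Qed.

Lemma oeq_iemb a b : a =~o b -> exists2 f : a -> b, iemb f & range f = setT.
Proof.
move=> [f fm fr]; exists f => //; split=> // x y _.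
by have : setT y by []; rewrite -fr => -[x' _ <-]; exists x'.
Qed.

Lemma olt_iemb a b : a <o b -> exists2 f : a -> b, iemb f & exists z, range f = [set y | wlt y z].
Proof.
move=> [z [f fm fr]]; exists f; last by exists z.
split=> // x y yx; have : [set y | wlt y z] y.
  apply: wlt_trans yx _; have : range f (f x) by exists x.
  by rewrite fr.
by rewrite -fr => -[x' _ <-]; exists x'.
Qed.

Lemma iemb_lt (a b : wordinal) (f : a -> b) z : iemb f -> ~ range f z -> a <o b.
Proof.
move=> [fm fi] nz.
have [|m nm mmin] := @wlt_min _ (~` range f); first by exists z.
exists m, f => //; apply/seteqP; split=> [_ [x _ <-]/=|y /= ym].
  have [//|/wltNge/wle_eqVlt[mfx|]] := pselect (wlt (f x) m).
    by case: nm; exists x.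
  by move=> /fi[x' fx']; case: nm; exists x'.
by apply: contrapT; exact: mmin.
Qed.

Lemma iemb_le (a b : wordinal) (f : a -> b) : iemb f -> a <=o b.
Proof.
move=> fi; have [[z nz]|nz] := pselect (exists z, ~ range f z).
  by left; exact: iemb_lt fi nz.
right; case: fi => fm _; exists f => //; apply/seteqP; split=> // z _.
by apply: contrapT => zz; apply: nz; exists z.
Qed.

Lemma ole_iemb a b : a <=o b -> exists f : a -> b, iemb f.
Proof. by case=> [/olt_iemb|/oeq_iemb] [f fi _]; exists f. Qed.

Lemma iemb_comp (a b c : wordinal) (f : a -> b) (g : b -> c) :
  iemb f -> iemb g -> iemb (g \o f).
Proof.
move=> [fm fi] [gm gi]; split=> [x y|x y /= yx]; first by rewrite /= gm fm.
have [w wy] := gi _ _ yx; rewrite -wy in yx *.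
have [|x' x'w] := fi x w; first by rewrite -(wlt_mono gm).
by exists x'; rewrite /= x'w.
Qed.

Lemma ole_trans b a c : a <=o b -> b <=o c -> a <=o c.
Proof.
by move=> /ole_iemb[f fi] /ole_iemb[g gi]; exact: iemb_le (iemb_comp fi gi).
Qed.

Lemma oltW a b : a <o b -> a <=o b. Proof. by left. Qed.

Lemma oeqW a b : a =~o b -> a <=o b. Proof. by right. Qed.

Lemma oeq_refl a : a =~o a.
Proof. by exists id => //; apply/seteqP; split=> // x _; exists x. Qed.

Lemma ole_refl a : a <=o a. Proof. exact/oeqW/oeq_refl. Qed.

Lemma oeq_sym a b : a =~o b -> b =~o a.
Proof.
move=> [f fm fr].
have /choice[g gf] : forall y, exists x, f x = y.
  by move=> y; have : setT y by []; rewrite -fr => -[x _ <-]; exists x.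
exists g; first by move=> x y; rewrite -fm !gf.
apply/seteqP; split=> // x _; exists (f x) => //.
by apply: (wmono_inj fm); rewrite gf.
Qed.

Lemma olt_le_trans b a c : a <o b -> b <=o c -> a <o c.
Proof.
move=> /olt_iemb[f fi [z fr]] /ole_iemb[g gi].
apply: (iemb_lt (iemb_comp fi gi) (z := g z)) => -[x _ /= gz].
have : range f (f x) by exists x.
by rewrite fr (wmono_inj (proj1 gi) gz) => /wlt_irr.
Qed.

Lemma ole_lt_trans b a c : a <=o b -> b <o c -> a <o c.
Proof.
move=> /ole_iemb[f fi] /olt_iemb[g gi [z gr]].
apply: (iemb_lt (iemb_comp fi gi) (z := z)) => -[x _ /= gz].
have : range g z by exists (f x).
by rewrite gr => /wlt_irr.
Qed.

Lemma oeq_trans b a c : a =~o b -> b =~o c -> a =~o c.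
Proof.
move=> [f fm fr] [g gm gr]; exists (g \o f); first by move=> x y /=; rewrite gm fm.
apply/seteqP; split=> // z _; have : setT z by [].
rewrite -gr => -[y _ <-]; have : setT y by [].
by rewrite -fr => -[x _ <-]; exists x.
Qed.

(** A least [x] with [f x < x] would have [f (f x) < f x] below it. *)
Lemma wmono_le (a : wordinal) (f : a -> a) x : {mono f : x y / wle x y} -> wle x (f x).
Proof.
move=> fm; apply/wltNge => fx.
have [|z fz zmin] := @wlt_min _ [set x | wlt (f x) x]; first by exists x.
by case: (zmin _ fz); rewrite /= (wlt_mono fm).
Qed.

Lemma olt_irr a : ~ a <o a.
Proof.
move=> [z [f fm fr]]; have : range f (f z) by exists z.
by rewrite fr /= => /wlt_le_trans/(_ (wmono_le z fm))/wlt_irr.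
Qed.

Lemma olt_nle a b : a <o b -> ~ b <=o a.
Proof. by move=> ab /(olt_le_trans ab)/olt_irr. Qed.

Lemma seg_iemb (a : wordinal) (x : a) : iemb (sval : seg x -> a).
Proof. by split=> // -[y yx] z /= zy; exists (exist _ z (wlt_trans zy yx)). Qed.

Lemma range_seg (a : wordinal) (x : a) : range (sval : seg x -> a) = [set y | wlt y x].
Proof. by apply/seteqP; split=> [_ [[y yx] _ <-]//|y yx]; exists (exist _ y yx). Qed.

Lemma seg_lt (a : wordinal) (x : a) : seg x <o a.
Proof. by exists x, sval; [exact: (proj1 (seg_iemb x))|exact: range_seg]. Qed.

Lemma same_range_oeq (a b c : wordinal) (f : a -> c) (g : b -> c) :
  {mono f : x y / wle x y} -> {mono g : x y / wle x y} ->
  range f = range g -> a =~o b.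
Proof.
move=> fm gm fg.
have /choice[h hP] : forall x, exists y, g y = f x.
  move=> x; have : range f (f x) by exists x.
  by rewrite fg => -[y _ <-]; exists y.
exists h; first by move=> x y; rewrite -gm !hP fm.
apply/seteqP; split=> // y _; have : range g (g y) by exists y.
by rewrite -fg => -[x _ xy]; exists x => //; apply: (wmono_inj gm); rewrite hP.
Qed.

Lemma oltP a b : a <o b <-> exists z : b, a =~o seg z.
Proof.
split=> [[z [f fm fr]]|[z az]].
  by exists z; apply: (same_range_oeq fm (proj1 (seg_iemb z))); rewrite fr range_seg.
by apply: ole_lt_trans (seg_lt z); exact: oeqW.
Qed.

Lemma seg_seg (a : wordinal) (x : a) (y : seg x) : seg y =~o seg (sval y).
Proof.
apply: (@same_range_oeq (seg y) (seg (sval y)) a (sval \o sval) sval) => //.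
rewrite range_seg; apply/seteqP; split=> [_ [[z zy] _ <-]//|z zy /=].
by exists (exist _ (exist _ z (wlt_trans zy (svalP y))) zy).
Qed.

Lemma seg_mono (a : wordinal) (x y : a) : wlt x y -> seg x <o seg y.
Proof.
move=> xy; apply/oltP; exists (exist _ x xy).
exact: oeq_sym (@seg_seg a y (exist _ x xy)).
Qed.

Lemma seg_le (a : wordinal) (x y : a) : wle x y -> seg x <=o seg y.
Proof. by move=> /wle_eqVlt[->|/seg_mono/oltW//]; exact: ole_refl. Qed.

Lemma olt_seg (a b : wordinal) (y : b) : a <o seg y -> exists2 w, wlt w y & a =~o seg w.
Proof.
move=> /oltP[w aw]; exists (sval w); first exact: svalP w.
exact: oeq_trans aw (seg_seg w).
Qed.

Lemma seg_inj (a : wordinal) (x y : a) : seg x =~o seg y -> x = y.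
Proof.
move=> xy; apply: wle_anti; apply: wltNge => /seg_mono/olt_nle; apply; apply: oeqW => //.
exact: oeq_sym.
Qed.

(** Sending [x] to the unique [y] with an isomorphic initial segment is itself
    an initial embedding. *)
Lemma segs_le (a b : wordinal) : (forall x : a, exists y : b, seg x =~o seg y) -> a <=o b.
Proof.
move=> /choice[f fP].
have flt x y : wlt x y -> wlt (f x) (f y).
  move=> /seg_mono xy; apply: contrapT => /wltNge/seg_le yx; apply: (olt_nle xy).
  apply: ole_trans (oeqW (fP y)) _; apply: ole_trans yx _.
  exact/oeqW/oeq_sym.
apply: (@iemb_le _ _ f); split=> [x y|x y /seg_mono yx].
  apply/idP/idP => [fxy|/wle_eqVlt[->|/flt/wltW//]]; last exact: wle_refl.
  by apply: wltNge => /flt /wlt_le_trans/(_ fxy)/wlt_irr.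
have /olt_seg[x' _ yx'] : seg y <o seg x.
  by apply: olt_le_trans yx _; exact/oeqW/oeq_sym.
by exists x'; apply/esym/seg_inj/(oeq_trans yx').
Qed.

(** If some initial segment of [a] is isomorphic to none of [b], the least such
    one embeds in [b] by [segs_le], hence exhausts [b]. *)
Lemma olt_le_total a b : a <=o b \/ b <o a.
Proof.
have [|] := pselect (forall x : a, exists y : b, seg x =~o seg y); first by left; exact: segs_le.
move=> /existsNP[x xP].
have [|m mP mmin] := @wlt_min _ [set x : a | ~ exists y : b, seg x =~o seg y]; first by exists x.
have /segs_le[/oltP//|mb] : forall x : seg m, exists y : b, seg x =~o seg y.
  move=> x'; have /contrapT[y xy] := mmin _ (svalP x').
  by exists y; exact: oeq_trans (seg_seg x') xy.
by right; apply/oltP; exists m; exact: oeq_sym.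
Qed.

Lemma ole_nlt a b : ~ b <o a -> a <=o b.
Proof. by have [] := olt_le_total a b. Qed.

Lemma ominP (P : wordinal -> Prop) : (exists a, P a) ->
  P (omin P) /\ forall a, P a -> omin P <=o a.
Proof.
move=> [a Pa]; rewrite /omin; case: pselect => [h|[]]; first exact: projT2 (cid h).
have [[b [Pb ba]]|nb] := pselect (exists b, P b /\ b <o a); last first.
  by exists a; split=> // b Pb; apply: ole_nlt => ba; apply: nb; exists b.
have [|z [c Pc cz] zmin] := @wlt_min _ [set z : a | exists2 c, P c & c =~o seg z].
  by move: ba => /oltP[z bz]; exists z, b.
exists c; split=> // d Pd; apply: ole_nlt => dc.
have /olt_seg[w wz dw] := olt_le_trans dc (oeqW cz).
by case: (zmin _ wz); exists d.
Qed.

Lemma cofP a : (exists f : cof a -> a, cofinal_map f) /\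
  forall (m : wordinal) (f : m -> a), cofinal_map f -> cof a <=o m.
Proof.
have [|cf cmin] := @ominP (fun m => exists f : m -> a, cofinal_map f).
  by exists a, id => x; exists x; exact: wle_refl.
by split=> // m f fc; apply: cmin; exists f.
Qed.

Lemma ole_inj a b : a <=o b -> exists f : a -> b, injective f.
Proof. by move=> /ole_iemb[f [/wmono_inj fi _]]; exists f. Qed.

Lemma card_le_inj (T U : Type) (B : set U) :
  [set: T] #<= B -> exists2 f : T -> U, injective f & forall x, B (f x).
Proof.
move=> /card_leP[f].
have mT (x : T) : x \in [set: T] by rewrite inE.
exists (fun x => sval (f (SigSub (mT x)))) => [x y /val_inj /(@inj _ _ _ f)|x].
  by rewrite !inE => /(_ Logic.I Logic.I) [].
by have := svalP (f (SigSub (mT x))); rewrite inE.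
Qed.

Lemma card_leTP (T U : Type) :
  [set: T] #<= [set: U] <-> exists f : T -> U, injective f.
Proof.
split=> [/card_le_inj[f fi _]|[f fi]]; first by exists f.
have fi' : set_inj [set: T] f by move=> x y _ _ /fi.
by rewrite -(card_le_eql (inj_card_eq fi')); exact: card_leT.
Qed.

Lemma olt_ind (P : wordinal -> Prop) :
  (forall a, (forall b, b <o a -> P b) -> P a) -> forall a, P a.
Proof.
move=> Pind a; apply: contrapT => nPa.
have [|nm mmin] := @ominP (fun a => ~ P a); first by exists a.
apply/nm/Pind => b bm; apply: contrapT => nPb.
exact: olt_nle bm (mmin _ nPb).
Qed.

(** * Cardinal arithmetic below a singular strong limit *)

Definition embeds (T U : Type) := exists f : T -> U, injective f.

Lemma embeds_trans U T V : embeds T U -> embeds U V -> embeds T V.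
Proof. by move=> [f fi] [g gi]; exists (g \o f); exact: inj_comp. Qed.

Lemma embeds_prod T U T' U' : embeds T T' -> embeds U U' -> embeds (T * U) (T' * U').
Proof.
move=> [f fi] [g gi]; exists (fun p => (f p.1, g p.2)).
by move=> [x y] [x' y'] [/fi-> /gi->].
Qed.

Lemma embeds_pow T U : embeds T U -> embeds (T -> bool) (U -> bool).
Proof.
move=> [f fi]; exists (fun s u => `[< exists2 t, f t = u & s t >]) => s s' ss'.
apply/funext => t; have [h h'] := asbool_eq_equiv (congr1 (@^~ (f t)) ss').
apply/idP/idP => st.
  by have [|t' /fi<-] := h; first by exists t.
by have [|t' /fi<-] := h'; first by exists t.
Qed.

Lemma embeds_finite T U : embeds T U -> finite_set [set: U] -> finite_set [set: T].
Proof. by move=> /card_leTP; exact: card_le_finite. Qed.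

(** If [x] were the maximum of [a], shifting a copy of [nat] by one would make
    room for [x] and inject [a] into the elements below [x]. *)
Lemma ocard_olimit a : ocard a -> infinite_set [set: a] -> olimit a.
Proof.
move=> acard ainf; split; first by have [x _] := infinite_setN0 ainf; exists x.
move=> x; apply: contrapT => /forallNP xmax.
have /infiniteP : infinite_set ([set: a] `\` [set x]).
  exact: infinite_setD ainf (finite_set1 x).
move=> /card_le_inj[h hi hx].
have hN n : h n <> x by have [] := hx n.
(* [x] takes the place of [h 0], which moves to [h 1], and so on. *)
pose f y := if pselect (y = x) then h 0 else
  if pselect (exists n, h n = y) is left e then h (projT1 (cid e)).+1 else y.
have fN y : f y <> x.
  rewrite /f; case: (pselect (y = x)) => yx; first exact: hN.
  by case: pselect => e; [exact: hN|exact: yx].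
have fi : injective f.
  move=> y z; rewrite /f.
  case: (pselect (y = x)) => yx; case: (pselect (z = x)) => zx /=.
  - by rewrite yx zx.
  - by case: pselect => [e /hi//|ne h0]; case: ne; exists 0.
  - by case: pselect => [e /hi//|ne h0]; case: ne; exists 0.
  case: pselect => ey; case: pselect => ez //.
  - by move=> /hi[]; case: (cid ey) (cid ez) => [m my] [n nz] /= mn; rewrite -my mn.
  - by move=> hz; case: ez; eexists; exact: hz.
  by move=> hz; case: ey; eexists; exact/esym/hz.
have fl y : wlt (f y) x.
  by apply: contrapT => /wltNge/wle_eqVlt[/esym/fN//|/xmax].
apply: (acard (seg x) (seg_lt x)); apply/card_leTP.
by exists (fun y => exist _ (f y) (fl y)) => y z [/fi].
Qed.

Section maxlex.
Variable a : wordinal.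
Implicit Types p q : a * a.

Let mx p := if wle p.1 p.2 then p.2 else p.1.

Let mx_ge p : wle p.1 (mx p) /\ wle p.2 (mx p).
Proof.
rewrite /mx; case: ifP => [->|/negbT /wltW ->]; by rewrite wle_refl.
Qed.

Definition maxlex p q := wlt (mx p) (mx q) ||
  wle (mx p) (mx q) && (wlt p.1 q.1 || wle p.1 q.1 && wle p.2 q.2).

Lemma maxlexP : well_order maxlex.
Proof.
apply: min_well_order => [p q|A [p Ap]].
  rewrite /maxlex => /andP[/orP[|/andP[pq]]].
    move=> pq /orP[/(wlt_trans pq)/wlt_irr//|/andP[/(wlt_le_trans pq)/wlt_irr]//].
  move=> pq' /orP[/(wle_lt_trans pq)/wlt_irr//|/andP[_]].
  move: pq' => /orP[pq' /orP[/(wlt_trans pq')/wlt_irr//|/andP[/(wlt_le_trans pq')/wlt_irr]//]|].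
  move=> /andP[pq1 pq2] /orP[/(wle_lt_trans pq1)/wlt_irr//|/andP[qp1 qp2]].
  by rewrite (surjective_pairing p) (surjective_pairing q) (wle_anti pq1 qp1) (wle_anti pq2 qp2).
have [|_ [p1 Ap1 <-] m1] := well_order_min (@wleP a) (A := mx @` A).
  by exists (mx p), p.
have [|_ [p2 [Ap2 p21] <-] m2] :=
    well_order_min (@wleP a) (A := fst @` [set p | A p /\ mx p = mx p1]).
  by exists p1.1, p1.
have [|_ [p3 [Ap3 p31 p32] <-] m3] :=
    well_order_min (@wleP a) (A := snd @` [set p | [/\ A p, mx p = mx p1 & p.1 = p2.1]]).
  by exists p2.2, p2.
exists p3 => // q Aq; rewrite /maxlex p31 p32.
have /wle_eqVlt[mq|->//] : wle (mx p1) (mx q) by apply: m1; exists q.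
rewrite mq wle_refl /=.
have /wle_eqVlt[q1|->] : wle p2.1 q.1 by apply: m2; exists q.
  rewrite -q1 wle_refl /= (m3 q.2) ?orbT//; by exists q.
by rewrite orbT.
Qed.

Definition omaxlex := WOrdinal maxlexP.

(** A pair below [p] has both coordinates at most the maximum of [p]. *)
Lemma omaxlex_seg (p : omaxlex) : olimit a -> exists n : a, embeds (seg p) (seg n * seg n).
Proof.
move=> [_ alim]; have [n mn] := alim (mx p); exists n.
have pn (q : seg p) : wlt (sval q).1 n /\ wlt (sval q).2 n.
  have qp : wle (mx (sval q)) (mx p).
    apply: wltNge => qp; move: (svalP q); rewrite /= /wlt /= {1}/maxlex.
    by rewrite qp.
  have [q1 q2] := mx_ge (sval q).
  by split; [apply: wle_lt_trans q1 _|apply: wle_lt_trans q2 _]; exact: wle_lt_trans mn.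
exists (fun q : seg p => (exist (fun y => wlt y n) _ (proj1 (pn q)),
                          exist (fun y => wlt y n) _ (proj2 (pn q)))).
move=> [[x y] xy] [[x' y'] xy'] [/= xx' yy']; move: xy xy'; rewrite xx' yy' => xy xy'.
by rewrite (Prop_irrelevance xy xy').
Qed.

End maxlex.

(** Hessenberg: the order of pairs by maximum has proper initial segments of
    smaller cardinality than [a], when [a] is an infinite cardinal. *)
Lemma embeds_square (a : wordinal) : infinite_set [set: a] -> embeds (a * a) a.
Proof.
elim/olt_ind: a => a IH ainf.
have [acard|] := pselect (ocard a); last first.
  move=> /existsNP[b /not_implyP[ba /contrapT/card_leTP ab]].
  have binf : infinite_set [set: b] by move=> /(embeds_finite ab).
  apply: embeds_trans (embeds_prod ab ab) _.
  by apply: embeds_trans (IH _ ba binf) _; exact/ole_inj/oltW.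
have [/ole_inj//|/oltP[p [f /wmono_inj fi _]]] := olt_le_total (omaxlex a) a.
have [n pn] := omaxlex_seg p (ocard_olimit acard ainf).
have an : embeds a (seg n * seg n) by apply: embeds_trans pn; exists f.
have [nfin|ninf] := pselect (finite_set [set: seg n]).
  by case: ainf; apply: embeds_finite an _; rewrite -setXTT; exact: finite_setX.
case: (acard _ (seg_lt n)); apply/card_leTP.
exact: embeds_trans an (IH _ (seg_lt n) ninf).
Qed.

Section singular.
Variable k : wordinal.
Hypotheses (k_sing : singular k) (k_pow : pow2lt_eq k).

Let k_card : ocard k. Proof. by case: k_sing. Qed.
Let k_lim : olimit k. Proof. by case: k_sing => kc ki _; exact: ocard_olimit. Qed.

Lemma cof_lt : cof k <o k. Proof. by case: k_sing. Qed.

Lemma nembeds_lt d : d <o k -> ~ embeds k d.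
Proof. by move=> dk /card_leTP; exact: k_card. Qed.

Lemma olimit_cof_infinite : infinite_set [set: cof k].
Proof.
have [[f fc] _] := cofP k; case: k_lim => _ lim fin.
suff [m mP] : exists m : k, forall i, wle (f i) m.
  have [y my] := lim m; have [i yi] := fc y.
  exact: wlt_irr (wlt_le_trans my (wle_trans yi (mP i))).
have [x0 _] : exists x : k, True by case: k_lim.
have /finite_set_leP[n /card_le_inj[j jinj jn]] := fin.
have [m mP] : exists m : k, forall i, (j i < n)%N -> wle (f i) m.
  elim: (n) => [|p [m mP]]; first by exists x0.
  have [[i ip]|np] := pselect (exists i, j i = p); last first.
    exists m => i; rewrite ltnS leq_eqVlt => /orP[/eqP ip|/mP//].
    by case: np; exists i.
  have [m' [mm' im']] := wlt_max2 m (f i); exists m' => i'.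
  rewrite ltnS leq_eqVlt => /orP[/eqP ip'|/mP im]; last exact: wle_trans mm'.
  by have <- : i = i' by apply: jinj; rewrite ip.
by exists m => i; apply: mP; exact: jn.
Qed.

Lemma ole_max d e : d <o k -> e <o k -> exists2 m, m <o k & d <=o m /\ e <=o m.
Proof.
move=> dk ek; have [de|/oltW ed] := olt_le_total d e.
  by exists e => //; split=> //; exact: ole_refl.
by exists d => //; split=> //; exact: ole_refl.
Qed.

(** The range of an embedding of [T] into [k] is an ordinal of its own; it lies
    below [k], since otherwise [k] would embed into [T]. *)
Lemma embeds_below T : embeds T k -> ~ embeds k T -> exists2 d, d <o k & embeds T d.
Proof.
move=> [j ji] nkT; exists (osub (range j)).
  have [kr|//] := olt_le_total k (osub (range j)).
  case: nkT; apply: embeds_trans (ole_inj kr) _.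
  have /choice[g gj] : forall x : osub (range j), exists t, j t = sval x.
    by move=> x; have [t _ jt] := svalP x; exists t.
  exists g => x y xy; move: (gj x) (gj y); rewrite xy => ->.
  exact: sval_inj.
have jr t : range j (j t) by exists t.
by exists (fun t => exist _ (j t) (jr t)) => t t' [/ji].
Qed.

(** Subsets of [d] are binary strings of length [d]. *)
Lemma embeds_pow_k d : d <o k -> embeds (d -> bool) k.
Proof.
move=> /oltP[a /oeq_sym[h hm hr]].
have /card_leTP : [set: bstring k] #<= [set: k] by rewrite (card_le_eql k_pow); exact: card_lexx.
apply: embeds_trans.
exists (fun s : d -> bool => existT (fun a => {b : k | wlt b a} -> bool) a (s \o h)).
move=> s s' ss'; have := projT2_eq ss'; rewrite (Prop_irrelevance (projT1_eq ss') erefl) /= => e.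
apply/funext => x; have : setT x by [].
by rewrite -hr => -[y _ <-]; exact: (congr1 (@^~ y) e).
Qed.

(** König's diagonal argument: [f i] avoids the values at [i] of the functions
    with code at most [g i]. Those codes are fewer than [k], so a value is left;
    and as [g] is cofinal, [f] differs from every coded function. *)
Lemma nembeds_fun_cof : ~ embeds (cof k -> k) k.
Proof.
move=> [j ji]; have [[g gc] _] := cofP k.
have /choice[f fP] : forall i, exists y : k, forall s, wle (j s) (g i) -> s i <> y.
  move=> i; apply: contrapT => /forallNP noy.
  have [n gn] := proj2 k_lim (g i).
  apply: (nembeds_lt (seg_lt n)).
  have /choice[h hP] : forall y, exists x : seg n, exists2 s, j s = sval x & s i = y.
    move=> y; have /existsNP[s /not_implyP[sg /contrapT sy]] := noy y.
    by exists (exist _ (j s) (wle_lt_trans sg gn)), s.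
  exists h => y z yz; have [s js <-] := hP y; have [t jt <-] := hP z.
  by move: js jt; rewrite yz => <- /ji->.
have [i fg] := gc (j f).
exact: fP fg _.
Qed.

(** If [k] embedded into the power set of [d], then into that of an infinite
    [m >= cof k] with [m < k], and [k ^ cof k <= 2 ^ (cof k * m) <= 2 ^ m <= k]
    would contradict König's theorem. *)
Lemma strong_limit d : d <o k -> exists2 e, e <o k & embeds (d -> bool) e.
Proof.
move=> dk; apply: embeds_below (embeds_pow_k dk) _ => kd.
have [m mk [dm cm]] := ole_max dk cof_lt.
have minf : infinite_set [set: m].
  by move=> /(embeds_finite (ole_inj cm)); exact: olimit_cof_infinite.
have [h hi] : embeds k (m -> bool) by exact: embeds_trans kd (embeds_pow (ole_inj dm)).
apply: nembeds_fun_cof; apply: embeds_trans (embeds_pow_k mk).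
apply: (@embeds_trans (m * m -> bool)); last exact/embeds_pow/embeds_square.
have : embeds (cof k * m -> bool) (m * m -> bool).
  by apply/embeds_pow/embeds_prod; [exact: ole_inj|exists id].
apply: embeds_trans; exists (fun s p => h (s p.1) p.2) => s s' ss'.
apply/funext => i; apply: hi; apply/funext => x.
exact: (congr1 (@^~ (i, x)) ss').
Qed.

Lemma lt_prod d e : d <o k -> e <o k -> exists2 m, m <o k & embeds (d * e) m.
Proof.
move=> dk ek; have [n nk [dn en]] := ole_max dk ek.
have [m mk [nm cm]] := ole_max nk cof_lt; exists m => //.
apply: (@embeds_trans (m * m)).
  by apply: embeds_prod; apply: ole_inj; [exact: ole_trans dn nm|exact: ole_trans en nm].
apply: embeds_square => /(embeds_finite (ole_inj cm)); exact: olimit_cof_infinite.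
Qed.

Lemma lt_fun d e : d <o k -> e <o k -> exists2 m, m <o k & embeds (d -> e) m.
Proof.
move=> dk ek; have [n nk den] := lt_prod dk ek.
have [m mk nm] := strong_limit nk; exists m => //.
apply: embeds_trans nm; apply: embeds_trans (embeds_pow den).
exists (fun f p => `[< f p.1 = p.2 >]) => f f' ff'; apply/funext => x.
have := congr1 (@^~ (x, f x)) ff'; rewrite /= asboolT// => /esym/asboolP.
by [].
Qed.

(** Covering [D] by the image of an ordinal below [k], rather than embedding
    [D] into it, makes the passage to subsets immediate. *)
Definition small T (D : set T) :=
  exists2 d, d <o k & exists e : d -> T, D `<=` range e.

Lemma small_sub T (D E : set T) : D `<=` E -> small E -> small D.
Proof. by move=> DE [d dk [e Ee]]; exists d => //; exists e; exact: subset_trans Ee. Qed.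

Lemma olt0 : onat 0 <o k.
Proof.
have [x _] := proj1 k_lim; apply: (ole_lt_trans _ (seg_lt x)).
have f0 : onat 0 -> seg x by case.
by apply: (@iemb_le _ _ f0); split=> -[].
Qed.

Lemma small_embeds T d : d <o k -> embeds T d -> small [set: T].
Proof.
move=> dk [f fi]; have [[t0 _]|T0] := pselect (exists t : T, True); last first.
  have e0 : onat 0 -> T by case.
  exists (onat 0); first exact: olt0.
  by exists e0 => t _; case: T0; exists t.
exists d => //.
exists (fun x => if pselect (exists t, f t = x) is left e then projT1 (cid e) else t0).
move=> t _; exists (f t) => //; case: pselect => [e|[]]; last by exists t.
by case: (cid e) => t' /= /fi.
Qed.

Lemma small_ord d : d <o k -> small [set: d].
Proof. by move=> dk; exists d => //; exists id => x _; exists x. Qed.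

Lemma small_seg (x : k) : small [set y | wlt y x].
Proof. by exists (seg x); [exact: seg_lt|exists sval; rewrite range_seg]. Qed.

Lemma small_setX T U (D : set T) (E : set U) : small D -> small E -> small (D `*` E).
Proof.
move=> [d dk [f Df]] [e ek [g Eg]]; have [m mk dem] := lt_prod dk ek.
have [n nk [h hr]] := small_embeds mk dem.
exists n => //; exists (fun x => (f (h x).1, g (h x).2)) => -[t u] [/= /Df[x _ <-] /Eg[y _ <-]].
have [z _ hz] : range h (x, y); first exact: hr.
by exists z => //; rewrite hz.
Qed.

Lemma small_fun d e : d <o k -> e <o k -> small [set: d -> e].
Proof. by move=> dk ek; have [m mk] := lt_fun dk ek; exact: small_embeds. Qed.

End singular.

(** * Unions of fewer than [k] sets *)

Section families.
Variables (k : wordinal) (X : Type).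
Implicit Types (F G H : set (set X)) (A B : set X).

Definition complements F : set (set X) := [set A | F (~` A)].

(** Indexing by initial segments of [k] keeps all index sets in one type, so
    that families of such unions are chosen without dependent indices. *)
Definition lt_unions F : set (set X) := [set A | exists (z : k) (B : k -> set X),
  (forall y, wlt y z -> F (B y)) /\ A = \bigcup_(y in [set y | wlt y z]) B y].

Definition unions_of (I : Type) F : set (set X) :=
  [set A | exists2 B : I -> set X, forall i, F (B i) & A = \bigcup_i B i].

Lemma lt_unions_sub F G : F `<=` G -> lt_unions F `<=` lt_unions G.
Proof. by move=> FG A [z [B [FB ->]]]; exists z, B; split=> // y yz; exact/FG/FB. Qed.

Lemma unions_of_sub I F G : F `<=` G -> unions_of I F `<=` unions_of I G.
Proof. by move=> FG A [B FB ->]; exists B => // i; exact/FG/FB. Qed.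

Hypotheses (k_sing : singular k) (k_pow : pow2lt_eq k).

Let k_lim : olimit k. Proof. by case: k_sing => kc ki _; exact: ocard_olimit. Qed.

(** All unions below are formed on whatever index type is convenient and brought
    back to an initial segment of [k] by this reindexing. *)
Lemma lt_unions_small F T (D : set T) (B : T -> set X) : small k D ->
  (forall t, D t -> F (B t)) -> lt_unions F (\bigcup_(t in D) B t).
Proof.
move=> [d /oltP[z /oeq_sym[h _ hr]] [e eD]] FB.
have [[t0 Dt0]|/set0P/negP/negPn/eqP ->] := pselect (D !=set0); last first.
  have [x _] := proj1 k_lim; have [|m _ mmin] := @wlt_min k setT; first by exists x.
  exists m, (fun=> set0); split=> [y /mmin[]//|]; rewrite bigcup_set0.
  by apply/esym/bigcup0.
(* Indices whose image falls outside [D] repeat the term at [t0]. *)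
pose f y := if pselect (wlt y z) is left yz then e (h (exist _ y yz)) else t0.
exists z, (fun y => if pselect (D (f y)) then B (f y) else B t0); split=> [y _|].
  by case: (pselect (D (f y))) => Df; exact: FB.
apply/seteqP; split=> [x [t Dt Btx]|x [y _]]; last first.
  by case: (pselect (D (f y))) => Df Bx; [exists (f y)|exists t0].
have [w _ wt] := eD _ Dt; have : setT w by [].
rewrite -hr => -[[y yz] _ hw]; exists y => //.
have -> : f y = t by rewrite /f; case: pselect => // yz'; rewrite (Prop_irrelevance yz' yz) hw.
by case: pselect.
Qed.

Lemma small1 T (t : T) : small k [set t].
Proof.
have [[x _] /(_ x)[y xy]] := k_lim; exists (seg y); first exact: seg_lt.
by exists (fun=> t) => _ ->; exists (exist _ x xy).
Qed.

Lemma sub_lt_unions F : F `<=` lt_unions F.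
Proof.
move=> A FA; rewrite -(bigcup_set1 (fun=> A) tt).
by apply: lt_unions_small => //; exact: small1.
Qed.

Lemma unions_of_lt (m : wordinal) F : m <o k -> unions_of m F `<=` lt_unions F.
Proof.
by move=> mk A [B FB ->]; apply: lt_unions_small => //; exact: small_ord.
Qed.

Lemma unions_of_unions_of (m n : wordinal) F : m <o k -> n <o k ->
  unions_of m (unions_of n F) `<=` lt_unions F.
Proof.
move=> mk nk A [B FB ->].
have /choice[K KP] : forall i, exists K : n -> set X, (forall j, F (K j)) /\ B i = \bigcup_j K j.
  by move=> i; have [K FK ->] := FB i; exists K.
have -> : \bigcup_i B i = \bigcup_(p in [set: m] `*` [set: n]) K p.1 p.2.
  apply/seteqP; split=> x.
    by move=> [i _]; rewrite (proj2 (KP i)) => -[j _ Kx]; exists (i, j).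
  by move=> [[i j] _ Kx]; exists i => //; rewrite (proj2 (KP i)); exists j.
apply: lt_unions_small => [|p _]; last exact: (proj1 (KP _)).
by apply: small_setX => //; exact: small_ord.
Qed.

(** A union of unions of lengths [z x < k], [x] ranging over fewer than [k]
    indices, may have length [k]. Sorting the [x] by the first term of a cofinal
    sequence of [k] above [z x] cuts it into [cof k] pieces, each of length less
    than [k]. *)
Lemma lt_unions_lt_unions F :
  lt_unions (lt_unions F) `<=` unions_of (cof k) (lt_unions F).
Proof.
move=> A [z [B [FB ->]]]; have [[g gc] _] := cofP k.
have /choice[zK zKP] : forall x, exists p : k * (k -> set X), wlt x z ->
    (forall y, wlt y p.1 -> F (p.2 y)) /\ B x = \bigcup_(y in [set y | wlt y p.1]) p.2 y.
  move=> x; have [xz|nxz] := pselect (wlt x z); last by exists (z, B).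
  by have [z' [K KP]] := FB x xz; exists (z', K).
have /choice[i iP] : forall x, exists i, wle (zK x).1 (g i) by move=> x; exact: gc.
pose D j := [set p : k * k | [/\ wlt p.1 z, wlt p.2 (zK p.1).1 & i p.1 = j]].
exists (fun j => \bigcup_(p in D j) (zK p.1).2 p.2) => [j|].
  apply: lt_unions_small => [|[x y] [/= xz yz _]]; last exact: (proj1 (zKP x xz)).
  apply: small_sub (small_setX k_sing (small_seg z) (small_seg (g j))).
  by move=> [x y] [/= xz yz <-]; split=> //=; exact: wlt_le_trans (iP x).
apply/seteqP; split=> t.
  move=> [x /= xz]; rewrite (proj2 (zKP x xz)) => -[y yz Kt].
  by exists (i x) => //; exists (x, y).
move=> [j _ [[x y] [/= xz yz _] Kt]].
by exists x => //; rewrite (proj2 (zKP x xz)); exists y.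
Qed.

(** Distributing a union of length [z] over intersections of length [m] yields
    an intersection indexed by functions from [z] to [m]. The bound [m] has to
    be uniform: a product of [z] ordinals unbounded in [k] may have [k] or more
    elements. *)
Lemma lt_unions_distr (m : wordinal) F : m <o k -> lt_unions F `<=` F ->
  F `<=` unions_of m (complements F) ->
  lt_unions (complements F) `<=` complements (lt_unions (complements F)).
Proof.
move=> mk FU FM A [z [B [FB AE]]].
have /choice[K KP] : forall x : seg z, exists K : m -> set X,
    (forall j, F (~` K j)) /\ ~` B (sval x) = \bigcup_j K j.
  by move=> x; have [K FK KE] := FM _ (FB _ (svalP x)); exists K.
suff : lt_unions (complements F) (~` A) by [].
have -> : ~` A = \bigcup_(f in [set: seg z -> m]) ~` (\bigcup_(x in [set: seg z]) ~` K x (f x)).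
  rewrite AE setC_bigcup; apply/seteqP; split=> t.
    move=> Bt; have /choice[f fP] : forall x : seg z, exists j, K x j t.
      move=> x; have : (~` B (sval x)) t by apply: Bt; exact: svalP x.
      by rewrite (proj2 (KP x)) => -[j _ Kt]; exists j.
    by exists f => // -[x _]; apply.
  move=> [f _ ft] x xz.
  have : (\bigcup_j K (exist _ x xz) j) t.
    exists (f (exist _ x xz)) => //; apply: contrapT => Kt.
    by apply: ft; exists (exist _ x xz).
  by rewrite -(proj2 (KP _)).
apply: lt_unions_small => [|f _]; first exact: small_fun (seg_lt z) mk.
rewrite /complements /= setCK; apply: FU; apply: lt_unions_small => [|x _].
  exact: small_ord (seg_lt z).
exact: (proj1 (KP x)).
Qed.

(** * Even and odd levels *)

(** What the construction of the next level uses of an even level. *)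
Definition additive (m : wordinal) F :=
  lt_unions F `<=` F /\ F `<=` unions_of m (complements F).

(** The sharper form valid at every even level except possibly the open sets: the
    pieces are of ambiguous class in [F]. *)
Definition ambiguous_additive (m : wordinal) F :=
  lt_unions F `<=` F /\ F `<=` unions_of m (F `&` complements F).

(** The form of an odd level. That [G] consists of unions of fewer than [k]
    members of some [H] is what makes [lt_unions_lt_unions] applicable to [G]. *)
Definition selfdual G := complements G = G /\ exists H, G = lt_unions H.

Lemma ambiguous_additiveW m F : ambiguous_additive m F -> additive m F.
Proof. by move=> [FU FM]; split=> // A /FM; apply: unions_of_sub => B []. Qed.

(** [lt_unions_distr] gives one inclusion between [U (C F)] and its dual; the
    other follows by taking complements. *)
Lemma additive_selfdual m F : m <o k -> additive m F ->
  selfdual (lt_unions (complements F)).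
Proof.
move=> mk [FU FM]; split; last by exists (complements F).
have sub := lt_unions_distr mk FU FM; apply/seteqP; split=> //.
by move=> A /sub; rewrite [complements _ _]/complements /= setCK.
Qed.

(** With [G = U H], a member of [U G = U (U H)] is a union of [cof k] members of
    [G], and doing this twice shows that [U G] is closed under [U]. *)
Lemma selfdual_ambiguous G : selfdual G ->
  ambiguous_additive (cof k) (lt_unions (complements G)).
Proof.
move=> [GC [H GE]]; rewrite GC.
have GM : lt_unions G `<=` unions_of (cof k) G.
  by rewrite {1}GE => A /lt_unions_lt_unions; rewrite -GE.
split=> [A /lt_unions_lt_unions|A /GM].
  by move=> /(unions_of_sub GM)/unions_of_unions_of; apply; exact: cof_lt.
apply: unions_of_sub => B GB; split; first exact: sub_lt_unions.
by apply: sub_lt_unions; rewrite -GC /complements /= setCK.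
Qed.

(** If [A] is a union of [m] sets whose complements lie in [F], then the
    complement of [A] is an intersection of [m] members of [F]. *)
Lemma additive_not_closed m F : additive m F -> ~ compl_closed F ->
  [/\ ~ inter_closed m F, ~ compl_closed (complements F) &
      ~ union_closed m (complements F)].
Proof.
move=> [FU FM] nFC.
have nFI : ~ inter_closed m F.
  move=> FI; apply: nFC => A /FM[B FB ->].
  by rewrite setC_bigcup; exact: FI.
split=> // [FC|FUm].
  apply: nFC => A FA; rewrite -[~` A]setCK; apply: (FC (~` A)).
  by rewrite /complements /= setCK.
apply: nFI => A FA; rewrite -[\bigcap_i A i]setCK setC_bigcap.
by apply: (FUm (fun i => ~` A i)) => i; rewrite /complements /= setCK.
Qed.

Lemma ambiguous_not_closed m F : ambiguous_additive m F -> ~ compl_closed F ->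
  ~ union_closed m (F `&` complements F) /\ ~ inter_closed m (F `&` complements F).
Proof.
move=> [FU FM] nFC.
have nFU : ~ union_closed m (F `&` complements F).
  by move=> FUm; apply: nFC => A /FM[B FB ->]; have [] := FUm B FB.
split=> // FI; apply: nFU => A FA; rewrite -[\bigcup_i A i]setCK setC_bigcup.
have [|] := FI (fun i => ~` A i); last by split=> //; rewrite /complements /= setCK.
by move=> i; have [FAi CFAi] := FA i; split; rewrite /complements /= ?setCK.
Qed.

(** For [G = U H], a member of [U G] is a union of [cof k] members of [G], so
    closure under unions of length [cof k] is as strong as closure under [U]. *)
Lemma selfdual_not_closed G : selfdual G -> ~ (lt_unions G `<=` G) ->
  ~ union_closed (cof k) G /\ ~ inter_closed (cof k) G.
Proof.
move=> [GC [H GE]] nGU.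
have nGM : ~ union_closed (cof k) G.
  move=> GM; apply: nGU => A; rewrite {1}GE => /lt_unions_lt_unions[B].
  by rewrite -GE => GB ->; exact: GM.
split=> // GI; apply: nGM => A GA; rewrite -GC /complements /= setC_bigcup.
by apply: GI => i; move: (GA i); rewrite -{1}GC.
Qed.

End families.

(** * Successor and limit levels *)

Lemma onat_lt m n : (m < n)%N -> onat m <o onat n.
Proof.
move=> mn; pose f (i : onat m) : onat n := exist _ (sval i) (ltn_trans (svalP i) mn).
have fi : iemb f.
  split=> // -[i im] [j jn] /=; rewrite /wlt /= -ltnNge => ji.
  by exists (exist _ j (ltn_trans ji im)); apply: sval_inj.
pose z : onat n := exist _ m mn; apply: (@iemb_lt _ _ f z fi) => -[[i im] _ /(congr1 sval) /= e].
by move: im; rewrite e ltnn.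
Qed.

Lemma onat_succ_le b n : b <o onat n.+1 -> b <=o onat n.
Proof.
move=> /oltP[z bz]; apply: ole_trans (oeqW bz) _.
have xn (x : seg z) : (sval (sval x) < n)%N.
  have := svalP x; rewrite /= /wlt /= -ltnNge => /leq_trans; apply.
  by rewrite -ltnS; exact: svalP z.
pose g (x : seg z) : onat n := exist _ (sval (sval x)) (xn x).
apply: (@iemb_le _ _ g); split=> // x y yx.
pose y' : onat n.+1 := exist _ (sval y) (ltnW (svalP y)).
have yz : wlt y' z by apply: wlt_trans (svalP x).
by exists (exist (fun t => wlt t z) y' yz); apply: sval_inj.
Qed.

Lemma oadd1_ge a : onat 1 <=o oadd (onat 1) a.
Proof.
apply: (@iemb_le _ _ (inl : onat 1 -> oadd (onat 1) a)); split=> // x [y _|//].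
by exists y.
Qed.

Lemma oadd_eqr (a b c : wordinal) : b =~o c -> oadd a b =~o oadd a c.
Proof.
move=> [f fm fr]; exists (fun x : oadd a b => match x with inl x => inl x | inr y => inr (f y) end).
  by move=> [x|x] [y|y] //=; exact: fm.
apply/seteqP; split=> // -[x|y] _; first by exists (inl x).
have : setT y by [].
by rewrite -fr => -[x _ <-]; exists (inr x).
Qed.

Lemma oadd_eq0 (a b : wordinal) : b =~o onat 0 -> oadd a b =~o a.
Proof.
move=> [g _ _]; have b0 (P : Type) : b -> P by move=> /g[].
exists (fun x : oadd a b => match x with inl x => x | inr y => b0 _ y end).
  by move=> [x|x] [y|y] //=; exact: b0.
by apply/seteqP; split=> // x _; exists (inl x).
Qed.

Definition level (l : wordinal) n := oadd (onat 1) (oadd l (onat n)).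

(** The last element of [1 + l + n + 1] cuts off [1 + l + n]. *)
Lemma level_succ l n : exists2 z : level l n.+1,
  level l n =~o seg z & forall y, wle y z.
Proof.
pose h (i : onat n) : onat n.+1 := exist _ (sval i) (ltnW (svalP i)).
pose f (x : level l n) : level l n.+1 := match x with
  | inl x => inl x | inr (inl y) => inr (inl y) | inr (inr i) => inr (inr (h i)) end.
pose z : level l n.+1 := inr (inr (exist _ n (ltnSn n))).
exists z; last first.
  by move=> [x|[y|[i ii]]] //=.
apply: (@same_range_oeq (level l n) (seg z) _ f sval) => //.
  by move=> [x|[x|x]] [y|[y|y]].
rewrite range_seg; apply/seteqP; split=> [_ [[x|[y|[i ii]]] _ <-]//=|].
  by rewrite /wlt /= -ltnNge.
move=> [x|[y|[i ii]]] //=; first by exists (inl x).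
  by exists (inr (inl y)).
rewrite /wlt /= -ltnNge => i_n; exists (inr (inr (exist _ i i_n))) => //=.
by congr (inr (inr _)); apply: sval_inj.
Qed.

Lemma level_lt_succ l n : level l n <o level l n.+1.
Proof. by have [z lz _] := level_succ l n; apply/oltP; exists z. Qed.

Lemma level_succ_le b l n : b <o level l n.+1 -> b <=o level l n.
Proof.
have [z lz zmax] := level_succ l n; move=> /oltP[y bY].
apply: ole_trans (oeqW bY) _; apply: ole_trans (seg_le (zmax y)) _.
exact/oeqW/oeq_sym.
Qed.

Lemma level_mono l m n : (m <= n)%N -> level l m <=o level l n.
Proof.
elim: n => [|n IH]; first by rewrite leqn0 => /eqP->; exact: ole_refl.
rewrite leq_eqVlt => /orP[/eqP->|]; first exact: ole_refl.
by rewrite ltnS => /IH /ole_trans; apply; exact/oltW/level_lt_succ.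
Qed.

Lemma level0 l : level l 0 =~o oadd (onat 1) l.
Proof. by apply: oadd_eqr; apply: oadd_eq0; exact: oeq_refl. Qed.

Lemma succ_not_limit l n : ~ olimit (oadd l (onat n.+1)).
Proof.
move=> [_ /(_ (inr (exist _ n (ltnSn n))))[[x|[i ii]]]]; rewrite /wlt //=.
by rewrite -ltnNge ltnNge -ltnS ii.
Qed.

Lemma olimit_eq a b : a =~o b -> olimit a -> olimit b.
Proof.
move=> [f fm fr] [[x _] alim]; split; first by exists (f x).
move=> y; have : setT y by [].
rewrite -fr => -[x' _ <-].
by have [x'' xx] := alim x'; exists (f x''); rewrite (wlt_mono fm).
Qed.

Section below_limit.
Variable l : wordinal.

(** The ordinal [1 + x]. *)
Definition below (x : l) := oadd (onat 1) (seg x).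

Lemma below_seg (x : l) : below x =~o seg (inr x : oadd (onat 1) l).
Proof.
pose f (u : below x) : oadd (onat 1) l := match u with inl i => inl i | inr y => inr (sval y) end.
apply: (@same_range_oeq (below x) (seg (inr x : oadd (onat 1) l)) _ f sval) => //.
  by move=> [i|[y yx]] [j|[z zx]].
rewrite range_seg; apply/seteqP; split=> [_ [[i|[y yx]] _ <-]//|[i|y] yx].
  by exists (inl i).
by exists (inr (exist _ y yx)).
Qed.

Lemma below_lt (x : l) : below x <o oadd (onat 1) l.
Proof. by apply/oltP; exists (inr x); exact: below_seg. Qed.

Lemma below_mono (x y : l) : wlt x y -> below x <o below y.
Proof.
move=> xy; apply: ole_lt_trans (oeqW (below_seg x)) _.
apply: olt_le_trans (oeqW (oeq_sym (below_seg y))).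
exact: seg_mono.
Qed.

(** An ordinal below [1 + l] is [0] or [1 + x] with [x < l]. *)
Lemma below_cofinal b : olimit l -> b <o oadd (onat 1) l -> exists x : l, b <=o below x.
Proof.
move=> [[x0 _] _] /oltP[[i|x] bz].
  exists x0; apply: ole_trans (oeqW bz) _; apply: ole_trans (oeqW (oeq_sym (below_seg x0))).
  by apply: seg_le.
by exists x; apply: ole_trans (oeqW bz) _; exact/oeqW/oeq_sym/below_seg.
Qed.

End below_limit.

(** * The Borel hierarchy at a singular strong limit *)

Section hierarchy.
Variables (k : wordinal) (X : topologicalType).
Hypotheses (k_sing : singular k) (k_pow : pow2lt_eq k).
Hypothesis X_open : bSigma X k (onat 1) `<=` bSigma X (ocard_succ (cof k)) (onat 2).

Local Notation S := (bSigma X k).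
Local Notation U := (@lt_unions k X).

Lemma ocard_succ_embeds d a : d <o ocard_succ a -> embeds d a.
Proof.
move=> da; apply/card_leTP; apply: contrapT => nda.
have [|_ /(_ d nda)] := @ominP (fun a' => ~ ([set: a'] #<= [set: a])); first by exists d.
exact: olt_nle da.
Qed.

(** The hypothesis on open sets, reindexed by [cof k]. *)
Lemma open_unions_closed : open `<=` unions_of (cof k) (complements (open : set (set X))).
Proof.
move=> V oV; have /X_open : S (onat 1) V by apply: bSigma_open => //; exact: oeq_refl.
rewrite bSigmaE; last exact: onat_lt.
move=> [d [A [/ocard_succ_embeds[f fi] bA ->]]].
have cA i : open (~` A i).
  have [b [b1 b2 ]] := bA i; rewrite /bPi /= (@bSigma1E _ _ b)//.
  by case: b1 => [b1|/oeq_sym//]; have := olt_nle b1 (onat_succ_le b2).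
(* The fibres of [f] have at most one element, so each term is closed: either
   some [A i] or empty. *)
exists (fun j => \bigcup_(i in [set i | f i = j]) A i).
  move=> j; rewrite /complements /=; have [[i ij]|nj] := pselect (exists i, f i = j).
    have -> : [set i | f i = j] = [set i].
      by apply/seteqP; split=> [i' /=|_ ->//]; rewrite -ij => /fi.
    by rewrite bigcup_set1.
  rewrite (_ : [set i | f i = j] = set0); first by rewrite bigcup_set0 setC0; exact: openT.
  by apply/seteqP; split=> // i ij; apply: nj; exists i.
by apply/seteqP; split=> x [i _]; [exists (f i) => //; exists i|move=> [i' _ Ax]; exists i'].
Qed.

Definition Pi_below a : set (set X) :=
  [set A | exists b, [/\ onat 1 <=o b, b <o a & bPi X k b A]].

Lemma bSigma_lt_unions a : onat 1 <o a -> S a = U (Pi_below a).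
Proof.
move=> a1; rewrite bSigmaE//; apply/seteqP; split=> [_ [d [A [dk bA ->]]]|_ [z [B [BP ->]]]].
  by apply: (lt_unions_small k_sing) => [|i _]; [exact: small_ord|exact: bA].
exists (seg z), (B \o sval); split; first exact: seg_lt.
  by move=> i; apply: BP; exact: svalP i.
by transitivity (\bigcup_(y in range (sval : seg z -> k)) B y);
  [rewrite range_seg|rewrite bigcup_image].
Qed.

(** Only the first level needs an argument: open sets lie in the second level
    because they are unions of [cof k] closed sets. *)
Lemma bSigma_mono a b : onat 1 <=o a -> a <=o b -> S a `<=` S b.
Proof.
move=> a1 ab A; have [a1'|a1'] := a1.
  have b1 : onat 1 <o b := olt_le_trans a1' ab.
  rewrite !bSigma_lt_unions//; apply: lt_unions_sub => B [c [c1 ca cB]].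
  by exists c; split=> //; exact: olt_le_trans ca ab.
have {}a1' := oeq_sym a1'; rewrite (bSigma1E _ _ a1') => oA.
have [b1|b1] := ole_trans a1 ab; last by apply: bSigma_open => //; exact: oeq_sym.
rewrite bSigma_lt_unions//.
have := open_unions_closed oA; move=> /(unions_of_lt k_sing (cof_lt k_sing)).
apply: lt_unions_sub => B; rewrite -(bSigma1E X k (oeq_refl _)) => cB.
by exists (onat 1); split=> //; exact: ole_refl.
Qed.

Lemma bPi_mono a b : onat 1 <=o a -> a <=o b -> bPi X k a `<=` bPi X k b.
Proof. by move=> a1 ab A; exact: bSigma_mono. Qed.

Lemma bPi_lt_bSigma a b : onat 1 <=o a -> a <o b -> U (bPi X k a) `<=` S b.
Proof.
move=> a1 ab; rewrite bSigma_lt_unions; last exact: ole_lt_trans a1 ab.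
by apply: lt_unions_sub => A aA; exists a.
Qed.

Lemma bPi_sub_bSigma a b : onat 1 <=o a -> a <o b -> bPi X k a `<=` S b.
Proof. by move=> a1 ab A aA; apply: (bPi_lt_bSigma a1 ab); exact: sub_lt_unions. Qed.

Lemma bSigma_sub_bPi a b : onat 1 <=o a -> a <o b -> S a `<=` bPi X k b.
Proof. by move=> a1 ab A aA; apply: (bPi_sub_bSigma a1 ab); rewrite /bPi /= setCK. Qed.

Lemma bSigma_sub_Bor a : S a `<=` Bor X k.
Proof.
move=> A; elim=> [c V _ oV F [_ oF]|c d b B c1 dk b1 bc _ IH F HF]; first exact: oF.
have [[FC FU] _] := HF.
by apply: (FU d dk) => i; rewrite -[B i]setCK; apply: FC; exact: IH i F HF.
Qed.

Lemma open_sub_bSigma a : onat 1 <=o a -> open `<=` S a.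
Proof.
move=> a1 V oV; apply: (bSigma_mono (ole_refl _) a1).
by apply: bSigma_open => //; exact: oeq_refl.
Qed.

Lemma Bor_sub (F : set (set X)) : open `<=` F -> compl_closed F -> U F `<=` F ->
  Bor X k `<=` F.
Proof.
move=> oF FC FU A; apply; split=> //; split=> // d dk B FB.
by apply: FU; apply: (lt_unions_small k_sing) => [|i _]; [exact: small_ord|exact: FB].
Qed.

Lemma bSigma_neq_Bor a : onat 1 <=o a -> a <o ord_bor X k -> S a <> Bor X k.
Proof.
move=> a1 ab SB; apply: (olt_nle ab).
have [|_] := @ominP (fun a => onat 1 <=o a /\ S a = Bor X k); first by exists a.
exact.
Qed.

Section level_props.
Variable l : wordinal.
Local Notation L := (level l).

Lemma bSigma_succ n : S (L n.+1) = U (complements (S (L n))).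
Proof.
have L1 m : onat 1 <=o L m by exact: oadd1_ge.
apply/seteqP; split.
  rewrite bSigma_lt_unions; last exact: ole_lt_trans (L1 n) (level_lt_succ l n).
  apply: lt_unions_sub => A [b [b1 /level_succ_le bn]].
  exact: bPi_mono.
exact: bPi_lt_bSigma (L1 n) (level_lt_succ l n).
Qed.

(** Each level is [U (C F)] for the previous one [F], so [additive_selfdual] and
    [selfdual_ambiguous] apply in turn. *)
Lemma bSigma_parity m : m <o k -> additive k m (S (L 0)) -> forall n,
  (odd n -> selfdual k (S (L n))) /\
  (~~ odd n -> (0 < n)%N -> ambiguous_additive k (cof k) (S (L n))).
Proof.
move=> mk add0; elim=> [|n [IHo IHe]] //=; rewrite bSigma_succ.
split=> [no|]; last by rewrite negbK => /IHo no _; exact: selfdual_ambiguous.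
case: n {IHo} no IHe => [_ _|n no IHe]; first exact: (additive_selfdual k_sing k_pow mk).
apply: (additive_selfdual k_sing k_pow (cof_lt k_sing)).
by apply: ambiguous_additiveW; exact: IHe.
Qed.

End level_props.

Lemma open_additive : additive k (cof k) (open : set (set X)).
Proof.
split; last exact: open_unions_closed.
by move=> _ [z [B [oB ->]]]; apply: bigcup_open.
Qed.

Section limit_level.
Variable l : wordinal.
Hypotheses (l_lim : olimit l) (l_lt : oadd (onat 1) l <o ord_bor X k).

Let b1 (x : l) : onat 1 <=o below x. Proof. exact: oadd1_ge. Qed.
Let bn (x : l) : exists2 y, wlt x y & below x <o below y.
Proof. by have [y xy] := proj2 l_lim x; exists y => //; exact: below_mono. Qed.

Lemma below_le (x y : l) : wle x y -> below x <=o below y.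
Proof. by move=> /wle_eqVlt[->|/below_mono/oltW//]; exact: ole_refl. Qed.

Let limE : S (oadd (onat 1) l) = U [set A | exists x : l, bPi X k (below x) A].
Proof.
have [x _] := proj1 l_lim.
rewrite bSigma_lt_unions; last exact: ole_lt_trans (b1 x) (below_lt x).
congr (lt_unions _); apply/seteqP; split=> A [].
  move=> b [b_1 /(below_cofinal l_lim)[y by_]] bA; exists y; exact: bPi_mono bA.
by move=> y yA; exists (below y); split=> //; exact: below_lt.
Qed.

(** Otherwise fewer than [k] sets of levels below [l] would always lie at a
    common level below [l], so that these levels would exhaust the Borel sets. *)
Lemma cof_limit_lt : cof l <o k.
Proof.
have [[d dk [f fc]]|nc] := pselect (exists2 d, d <o k & exists f : d -> l, cofinal_map f).
  exact: ole_lt_trans (proj2 (cofP l) _ _ fc) dk.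
pose F : set (set X) := [set A | exists x : l, S (below x) A].
have FS : F `<=` S (oadd (onat 1) l).
  by move=> A [x]; apply: bSigma_mono => //; exact/oltW/below_lt.
case: (bSigma_neq_Bor (oadd1_ge l) l_lt); apply/seteqP; split; first exact: bSigma_sub_Bor.
apply: subset_trans FS; apply: Bor_sub.
- move=> V oV; have [x _] := proj1 l_lim; exists x; exact: open_sub_bSigma.
- move=> A [x xA]; have [y _ xy] := bn x; exists y.
  exact: (bSigma_sub_bPi _ xy).
move=> _ [z [B [FB ->]]].
have /choice[f fP] : forall y : seg z, exists x : l, S (below x) (B (sval y)).
  by move=> y; exact: FB _ (svalP y).
have /existsNP[x /forallNP xf] : ~ cofinal_map f.
  by move=> fc; apply: nc; exists (seg z); [exact: seg_lt|exists f].
have [y _ xy] := bn x; have [w _ yw] := bn y; exists w.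
apply: (bPi_lt_bSigma _ yw) => //; exists z, B; split=> // t tz.
apply: (bSigma_sub_bPi _ xy) => //; apply: bSigma_mono (fP (exist _ t tz)) => //.
by apply: below_le; apply: wltW; apply/negP; exact: xf.
Qed.

(** Sorting the terms of a union along a cofinal sequence of [l] groups those
    of bounded level, and each group lies at a level below [l]. *)
Lemma limit_ambiguous : ambiguous_additive k (cof l) (S (oadd (onat 1) l)).
Proof.
have [[g gc] _] := cofP l.
pose H : set (set X) := [set A | exists x : l, bPi X k (below x) A].
have HM : U H `<=` unions_of (cof l) [set A | exists x : l, S (below x) A].
  move=> _ [z [B [HB ->]]].
  have /choice[x xP] : forall y : seg z, exists x : l, bPi X k (below x) (B (sval y)).
    by move=> y; exact: HB _ (svalP y).
  exists (fun j => \bigcup_(y in [set y | wle (x y) (g j)]) B (sval y)) => [j|].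
    have [w _ gw] := bn (g j); exists w; apply: (bPi_lt_bSigma _ gw) => //.
    apply: (@lt_unions_small _ _ k_sing) => [|y /= yj].
      exact: small_sub (small_ord (seg_lt z)).
    by apply: bPi_mono (xP y) => //; exact: below_le.
  apply/seteqP; split=> t [y].
    move=> yz Bt; have [j xj] := gc (x (exist _ y yz)).
    by exists j => //; exists (exist _ y yz).
  by move=> _ [y' _ Bt]; exists (sval y') => //; exact: svalP y'.
have SH : [set A | exists x : l, S (below x) A] `<=` H.
  by move=> A [x xA]; have [y _ xy] := bn x; exists y; exact: bSigma_sub_bPi xA.
rewrite limE -/H; split.
  move=> A /(lt_unions_lt_unions k_sing).
  move=> /(unions_of_sub (subset_trans HM (unions_of_sub SH))).
  by apply: unions_of_unions_of => //; [exact: cof_lt|exact: cof_limit_lt].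
move=> A /HM; apply: unions_of_sub => B [x xB]; rewrite -limE; split.
  by apply: bSigma_mono xB => //; exact/oltW/below_lt.
exact: bSigma_sub_bPi (below_lt x) _ xB.
Qed.

End limit_level.

End hierarchy.

(** * Subspaces of the space of binary sequences of length [k] *)

Definition agree (k : wordinal) (a : k) (x y : gcantor k) :=
  forall b, wlt b a -> y b = x b.

Lemma agree_sym (k : wordinal) (a : k) x y : agree a x y -> agree a y x.
Proof. by move=> xy b /xy. Qed.

Lemma agree_trans (k : wordinal) (a : k) x y z : agree a x y -> agree a y z -> agree a x z.
Proof. by move=> xy yz b ba; rewrite yz// xy. Qed.

Lemma agree_le (k : wordinal) (a b : k) x y : wle a b -> agree b x y -> agree a x y.
Proof. by move=> ab xy c ca; apply: xy; exact: wlt_le_trans ab. Qed.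

Lemma open_gcyl (k : wordinal) (s : bstring k) : open (gcyl s).
Proof.
exists [set gcyl s]; last by rewrite bigcup_set1.
by move=> _ ->; apply: (@finI_from1 _ _ (range (@gcyl k)) id); exists s.
Qed.

Lemma open_agree (k : wordinal) (a : k) (V : set (gcantor k)) :
  (forall x y, V x -> agree a x y -> V y) -> open V.
Proof.
move=> Va.
have -> : V = \bigcup_(x in V)
    gcyl (existT _ a (x \o sval) : bstring k).
  apply/seteqP; split=> [x Vx|y [x Vx xy]]; first by exists x.
  by apply: Va Vx _ => b ba; exact: xy (exist _ b ba).
by apply: bigcup_open => x _; exact: open_gcyl.
Qed.

(** A finite intersection of cylinders around [x] contains the cylinder given by
    the longest of them; [k0] serves the empty intersection. *)
Lemma nbhs_agree (k : wordinal) (k0 : k) (V : set (gcantor k)) x :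
  open V -> V x -> exists a : k, forall y, agree a x y -> V y.
Proof.
move=> oV; have [D DV VE] : exists2 D : set (set (gcantor k)),
    D `<=` finI_from (range (@gcyl k)) id & \bigcup_(W in D) W = V := oV.
rewrite -VE => -[W DW Wx]; have [E ED EW] := DV W DW.
have Ex i : i \in E -> range (@gcyl k) i /\ i x.
  by move=> iE; split; [have := ED i iE; rewrite inE|move: Wx; rewrite -EW; exact].
suff [a aP] : exists a : k, forall i y, i \in E -> agree a x y -> i y.
  by exists a => y xy; exists W => //; rewrite -EW => i /= iE; exact: aP iE xy.
have : forall i, i \in (E : seq _) -> range (@gcyl k) i /\ i x by [].
suff : forall s : seq (set (gcantor k)), (forall i, i \in s -> range (@gcyl k) i /\ i x) ->
    exists a : k, forall i y, i \in s -> agree a x y -> i y by apply.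
elim=> [|i s IH] sP; first by exists k0.
have [|a aP] := IH; first by move=> j js; apply: sP; rewrite inE js orbT.
have [[[b t] _ bti] ix] := sP i (mem_head _ _).
have [c [ac bc]] := wlt_max2 a b; exists c => j y.
rewrite inE => /orP[/eqP-> xy|js xy]; last by apply: aP js _; exact: agree_le xy.
rewrite -bti in ix *; move=> d; transitivity (x (sval d)); last exact: ix.
by apply: xy; exact: wlt_le_trans (svalP d) bc.
Qed.

(** At each length [a] the sets saturated for agreement below [a] are clopen;
    an open set is the union of its saturated parts at cofinally many lengths. *)
Lemma gcantor_ambiguous (k : wordinal) (X : topologicalType) : embeds_gcantor k X ->
  singular k -> ambiguous_additive k (cof k) (open : set (set X)).
Proof.
move=> [e ei eo] k_sing.
have sat (a : k) (W : set X) :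
    (forall x y, W x -> agree a (e x) (e y) -> W y) -> open W.
  move=> Wa; apply/eo; exists [set z | exists2 x, W x & agree a (e x) z].
    by apply: (@open_agree _ a) => z z' [x Wx xz] zz'; exists x => //; exact: agree_trans zz'.
  by apply/seteqP; split=> [y [x Wx]|y Wy]; [exact: Wa|exists y].
have [[g gc] _] := cofP k.
split=> [_ [z [B [oB ->]]]|W /eo[V oV VW]]; first exact: bigcup_open.
pose P i := [set x | forall y, agree (g i) (e x) (e y) -> W y].
have Psat i x y : P i x -> agree (g i) (e x) (e y) -> P i y.
  by move=> Px xy z yz; apply: Px; exact: agree_trans yz.
exists P => [i|].
  split; first exact: sat (Psat i).
  apply: (sat (g i)) => x y nPx xy Py; apply: nPx; apply: Psat Py _; exact: agree_sym.
apply/seteqP; split=> [x Wx|x [i _]]; last by apply.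
have Vx : V (e x) by move: Wx; rewrite -VW.
have [[k0 _] _] : olimit k by case: k_sing => kc ki _; exact: ocard_olimit.
have [a aV] := nbhs_agree k0 oV Vx; have [i ai] := gc a.
by exists i => // y xy; rewrite -VW; apply: aV; exact: agree_le xy.
Qed.

(** * Closure properties of the levels *)

Lemma ohat_limit k a : olimit a -> ohat k a = cof a.
Proof. by rewrite /ohat; case: pselect. Qed.

Lemma ohat_nlimit k a : ~ olimit a -> ohat k a = cof k.
Proof. by rewrite /ohat; case: pselect. Qed.

Lemma oeq0_nlimit a : a =~o onat 0 -> ~ olimit a.
Proof. by move=> /olimit_eq a0 /a0[[[]]]. Qed.

Section main.
Variables (k : wordinal) (X : topologicalType).
Hypotheses (k_sing : singular k) (k_pow : pow2lt_eq k).
Hypothesis X_open : bSigma X k (onat 1) `<=` bSigma X (ocard_succ (cof k)) (onat 2).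
Local Notation S := (bSigma X k).

Lemma bSigma_oeq a b : onat 1 <=o a -> a =~o b -> S a = S b.
Proof.
move=> a1 ab; have b1 : onat 1 <=o b := ole_trans a1 (oeqW ab).
by apply/seteqP; split; apply: bSigma_mono => //; [exact: oeqW|exact/oeqW/oeq_sym].
Qed.

Lemma bSigma_zero a : a =~o onat 0 -> S (oadd (onat 1) a) = open.
Proof. by move=> a0; apply: bSigma1E; exact: oadd_eq0. Qed.

Lemma zero_limit_additive l : l =~o onat 0 \/ olimit l -> level l 0 <o ord_bor X k ->
  exists2 m, m <o k & additive k m (S (level l 0)).
Proof.
move=> lP lb; rewrite (bSigma_oeq (oadd1_ge _) (level0 l)).
case: lP => [l0|l_lim].
  rewrite bSigma_zero//; exists (cof k); [exact: cof_lt|exact: open_additive].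
have {}lb : oadd (onat 1) l <o ord_bor X k.
  by apply: ole_lt_trans lb; exact/oeqW/oeq_sym/level0.
exists (cof l); [exact: cof_limit_lt lb|apply: ambiguous_additiveW; exact: limit_ambiguous].
Qed.

Variable a : wordinal.
Hypothesis a_lt : oadd (onat 1) a <o ord_bor X k.

Let level_eq l n : a =~o oadd l (onat n) -> oadd (onat 1) a =~o level l n.
Proof. exact: oadd_eqr. Qed.

Let base l n : l =~o onat 0 \/ olimit l -> a =~o oadd l (onat n) ->
  exists2 m, m <o k & additive k m (S (level l 0)).
Proof.
move=> lP al; apply: zero_limit_additive => //; apply: ole_lt_trans a_lt.
apply: ole_trans (level_mono l (leq0n n)) _.
exact/oeqW/oeq_sym/level_eq.
Qed.

(** Otherwise the level would be closed under all Borel operations, against its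
    being below the order of [X]. *)
Lemma lt_unions_not_compl_closed :
  lt_unions k (S (oadd (onat 1) a)) `<=` S (oadd (onat 1) a) ->
  ~ compl_closed (S (oadd (onat 1) a)).
Proof.
move=> SU SC; apply: (bSigma_neq_Bor (oadd1_ge a) a_lt).
apply/seteqP; split; first exact: bSigma_sub_Bor.
by apply: Bor_sub => //; apply: open_sub_bSigma => //; exact: oadd1_ge.
Qed.

(** An even ordinal is zero, a limit, or has finite part at least [2]; these cases
    determine the value of [ohat]. *)
Lemma even_additive : oeven a -> a =~o onat 0 \/
  ambiguous_additive k (ohat k a) (S (oadd (onat 1) a)).
Proof.
move=> [l [n [lP al /negbT n_even]]].
have [n0|n_pos] := posnP n.
  have al0 : a =~o l.
    by rewrite n0 in al; apply: oeq_trans al _; apply: oadd_eq0; exact: oeq_refl.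
  case: lP => [l0|l_lim]; first by left; exact: oeq_trans al0 l0.
  have a_lim := olimit_eq (oeq_sym al0) l_lim.
  by right; rewrite ohat_limit//; exact: limit_ambiguous.
right; have [m mk lm] := base lP al.
rewrite ohat_nlimit; last first.
  move=> a_lim; case: n n_pos al {n_even} => // n _ al.
  exact: (@succ_not_limit l n (olimit_eq al a_lim)).
rewrite (bSigma_oeq (oadd1_ge a) (level_eq al)).
exact: (proj2 (bSigma_parity k_sing k_pow X_open mk lm n)).
Qed.

Lemma odd_selfdual : oodd a ->
  selfdual k (S (oadd (onat 1) a)).
Proof.
move=> [l [n [lP al n_odd]]]; have [m mk lm] := base lP al.
rewrite (bSigma_oeq (oadd1_ge a) (level_eq al)).
exact: (proj1 (bSigma_parity k_sing k_pow X_open mk lm n)).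
Qed.

End main.

Theorem proposition5p8 (kappa : wordinal) (X : topologicalType) (alpha : wordinal)
  (k_sing : singular kappa) (k_unc : ~ countable [set: kappa]) (k_pow : pow2lt_eq kappa)
  (X_ne : [set: X] !=set0) (X_reg : regular_space X) (X_haus : hausdorff_space X)
  (X_wt : weight_le X kappa)
  (X_open : bSigma X kappa (onat 1) `<=` bSigma X (ocard_succ (cof kappa)) (onat 2))
  (a_lt : oadd (onat 1) alpha <o ord_bor X kappa) :
  let a1 := oadd (onat 1) alpha in
  let Sigma := bSigma X kappa a1 in
  let Pi := bPi X kappa a1 in
  let Delta := bDelta X kappa a1 in
  let ah := ohat kappa alpha in
  (oeven alpha ->
     [/\ ~ compl_closed Sigma, ~ inter_closed ah Sigma,
         ~ compl_closed Pi & ~ union_closed ah Pi] /\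
     (onat 0 <o alpha -> ~ union_closed ah Delta /\ ~ inter_closed ah Delta) /\
     (alpha =~o onat 0 -> embeds_gcantor kappa X ->
        ~ union_closed ah Delta /\ ~ inter_closed ah Delta)) /\
  (oodd alpha ->
     [/\ Sigma = Pi, Pi = Delta,
         ~ union_closed (cof kappa) Sigma & ~ inter_closed (cof kappa) Sigma]).
Proof.
move=> a1 Sigma Pi Delta ah.
have not_closed : lt_unions kappa Sigma `<=` Sigma -> ~ compl_closed Sigma.
  exact: lt_unions_not_compl_closed.
split=> [a_even|a_odd]; last first.
  have [GC GU] : selfdual kappa Sigma by exact: odd_selfdual.
  have SP : Sigma = Pi by rewrite -{1}GC.
  have [|nU nI] := selfdual_not_closed k_sing (conj GC GU).
    by move=> /not_closed; apply => A SA; rewrite -GC /complements /= setCK.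
  by split=> //; rewrite /Delta /bDelta -/Sigma -/Pi SP setIid.
have zero_hat : alpha =~o onat 0 -> ah = cof kappa /\ Sigma = open.
  by move=> a0; rewrite /ah ohat_nlimit ?/Sigma ?bSigma_zero//; exact: oeq0_nlimit.
have cases : alpha =~o onat 0 \/ ambiguous_additive kappa ah Sigma by exact: even_additive.
have add : additive kappa ah Sigma.
  case: cases => [/zero_hat[-> ->]|/ambiguous_additiveW//].
  exact: open_additive.
have nC : ~ compl_closed Sigma by apply: not_closed; case: add.
split; first by have [nI nPC nPU] := additive_not_closed add nC.
split=> [a_pos|a0 Xk].
  case: cases => [a0|/ambiguous_not_closed]; last exact.
  by case: (olt_nle a_pos); exact: oeqW.
have [hE SE] := zero_hat a0.
have amb : ambiguous_additive kappa ah Sigma by rewrite hE SE; exact: gcantor_ambiguous.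
exact: ambiguous_not_closed amb nC.
Qed.
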